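(* There exist absolute constants $0<c<C$ such that for every $p=p(n)$ with $n^{-0.99}\le p\le 1-n^{-1}$, with probability tending to $1$ as $n\to\infty$ the minimum dimension $d$ such that $G=G(n,p)$ is a graph of touching spheres in $\mathbb{R}^d$ satisfies $$c\,\frac{n\log(1/(1-p))}{\log n}\le d\le C\,\frac{n\log(1/(1-p))}{\log n}.$$
   Context: A graph $G$ on $[n]$ is a graph of touching spheres in $\mathbb{R}^d$ if there are centers $u_1,\dots,u_n\in\mathbb{R}^d$ and radii $r_1,\dots,r_n>0$ (the sphere $S_i$ having center $u_i$ and radius $r_i$) such that for every pair of adjacent vertices $i,j$ the spheres $S_i,S_j$ touch externally, i.e. $\|u_i-u_j\|_2=r_i+r_j$ (no condition on nonadjacent pairs). $G(n,p)$ denotes the binomial random graph on $[n]$ in which each pair is an edge independently with probability $p$. *)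

(* Defs.v *)
From Stdlib Require Import Reals ClassicalEpsilon.
From mathcomp Require Import all_boot.

Set Implicit Arguments.
Unset Strict Implicit.
Unset Printing Implicit Defensive.

(* Potential edges of a simple graph on [n] = 'I_n : ordered pairs (i,j), i<j. *)
Definition upper (n : nat) : {set 'I_n * 'I_n} :=
  [set e : 'I_n * 'I_n | (nat_of_ord e.1 < nat_of_ord e.2)%N].

Definition adj (n : nat) (A : {set 'I_n * 'I_n}) (i j : 'I_n) : bool :=
  ((i, j) \in A) || ((j, i) \in A).

Definition dist2 (d : nat) (x y : 'I_d -> R) : R :=
  sqrt (\big[Rplus/R0]_(k < d) Rsqr (Rminus (x k) (y k))).

Definition touching_spheres (d n : nat) (G : 'I_n -> 'I_n -> bool) : Prop :=
  exists (u : 'I_n -> 'I_d -> R) (r : 'I_n -> R),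
    (forall i, Rlt R0 (r i)) /\
    (forall i j, G i j -> dist2 (u i) (u j) = Rplus (r i) (r j)).

Definition prob_Gnp (n : nat) (p : R) (E : {set 'I_n * 'I_n} -> Prop) : R :=
  \big[Rplus/R0]_(A : {set 'I_n * 'I_n} | A \subset upper n)
     Rmult (Rmult (pow p #|A|) (pow (Rminus R1 p) (#|upper n| - #|A|)))
           (if excluded_middle_informative (E A) then R1 else R0).

(* The minimum dimension d such that G is a touching-spheres graph in R^d
   lies in [lo, hi]: written out as "some d with d <= hi works (so the minimum
   exists and is <= hi), and every working d is >= lo (so the minimum is >= lo)". *)
Definition min_touch_dim_between (n : nat) (G : 'I_n -> 'I_n -> bool) (lo hi : R) : Prop :=
  (exists d : nat, touching_spheres d G /\ Rle (INR d) hi) /\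
  (forall d : nat, touching_spheres d G -> Rle lo (INR d)).

(* Main.v *)
Require Import Defs.
From Stdlib Require Import Reals ClassicalEpsilon Lra ZArith.
From mathcomp Require Import all_boot all_order all_algebra boolp zify Rstruct.
Set Implicit Arguments.
Unset Strict Implicit.
Unset Printing Implicit Defensive.
Import Order.TTheory GRing.Theory Num.Theory.

(** Lower bound.  Centres [u_i] and radii [r_i] realizing [G] in dimension [d]
    give the symmetric matrix [|u_i - u_j|^2 - (r_i + r_j)^2], of rank at most
    [d + 3], with nonzero diagonal and zeros on the edges of [G].  Following
    Golovnev, Regev and Weinstein, a rank [k] matrix of this kind has a principal
    submatrix with [s] nonzero entries that is recovered from a row basis [R] with
    [m <= k s / n] nonzero entries.  By the count of zero patterns of polynomials
    there are only [n^(6m)] possible supports for a given [m], while a given one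
    avoids [G] with probability about [(1-p)^(s/2)], so the union bound excludes
    every [k] below a small multiple of [n log(1/(1-p)) / log n].

    Upper bound.  A proper colouring of [G] with [K] colours realizes [G] in
    dimension [K]: vertices of colour [a] all get the same sphere, centred at
    [sqrt 2 e_a].  Colouring the vertices greedily, each one fails to fit with
    probability at most [exp (- K (1-p)^(n/K))]. *)

(** * Zero patterns of polynomials *)

Section PolynomialFunctions.
Variables (F : fieldType) (m : nat).
Local Open Scope ring_scope.
Implicit Types (f g : ('I_m -> F) -> F) (D : nat).

(* The degree bound applies to each variable separately, so that there are
   exactly (D+1)^m monomials of degree at most D. *)
Definition polyfun D f : Prop :=
  exists s : seq (F * {ffun 'I_m -> nat}),
    (forall t, t \in s -> forall l, (t.2 l <= D)%N) /\
    forall x, f x = \sum_(t <- s) t.1 * \prod_l x l ^+ t.2 l.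

Lemma polyfun_ext D f g : f =1 g -> polyfun D f -> polyfun D g.
Proof. by move=> fg [s [sD fE]]; exists s; split=> // x; rewrite -fg. Qed.

Lemma polyfun_le D D' f : (D <= D')%N -> polyfun D f -> polyfun D' f.
Proof.
by move=> DD' [s [sD fE]]; exists s; split=> // t ts l; apply: leq_trans DD'; apply: sD.
Qed.

Lemma polyfun_cst D c : polyfun D (fun=> c).
Proof.
exists [:: (c, [ffun=> 0%N])]; split=> [t | x].
  by rewrite inE => /eqP-> l; rewrite ffunE.
by rewrite big_seq1 big1 ?mulr1 // => l _; rewrite ffunE.
Qed.

Lemma polyfun_var D l : polyfun D.+1 (fun x => x l).
Proof.
exists [:: (1, [ffun l' => (l' == l) : nat])]; split=> [t | x].
  by rewrite inE => /eqP-> l'; rewrite ffunE; case: (_ == _).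
rewrite big_seq1 mul1r (bigD1 l) //= ffunE eqxx big1 ?mulr1 // => l' /negPf nl.
by rewrite ffunE nl.
Qed.

Lemma polyfunD D f g : polyfun D f -> polyfun D g -> polyfun D (fun x => f x + g x).
Proof.
move=> [s [sD fE]] [s' [sD' gE]]; exists (s ++ s'); split=> [t | x].
  by rewrite mem_cat => /orP[/sD | /sD'].
by rewrite big_cat fE gE.
Qed.

Lemma polyfunM D1 D2 f g :
  polyfun D1 f -> polyfun D2 g -> polyfun (D1 + D2) (fun x => f x * g x).
Proof.
move=> [s [sD fE]] [s' [sD' gE]].
pose T := (F * {ffun 'I_m -> nat})%type.
exists [seq (t.1 * t'.1, [ffun l => (t.2 l + t'.2 l)%N]) | t : T <- s, t' : T <- s'].
split=> [_ /allpairsP[[t t'] /= [ts ts' ->]] l | x].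
  by rewrite ffunE leq_add ?sD ?sD'.
rewrite big_allpairs_dep /= fE gE mulr_suml; apply: eq_bigr => t _.
rewrite mulr_sumr; apply: eq_bigr => t' _; rewrite mulrACA -big_split /=.
by congr (_ * _); apply: eq_bigr => l _; rewrite ffunE exprD.
Qed.

Lemma polyfun_sum (I : Type) (r : seq I) (P : pred I) D (f : I -> ('I_m -> F) -> F) :
  (forall i, P i -> polyfun D (f i)) -> polyfun D (fun x => \sum_(i <- r | P i) f i x).
Proof.
move=> fD; elim: r => [|i r IHr].
  by apply: polyfun_ext (polyfun_cst D 0) => x; rewrite big_nil.
have [Pi | nPi] := boolP (P i).
  by apply: polyfun_ext (polyfunD (fD i Pi) IHr) => x; rewrite big_cons Pi.
by apply: polyfun_ext IHr => x; rewrite big_cons (negPf nPi).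
Qed.

Lemma polyfun_prod (I : Type) (r : seq I) (P : pred I) D (f : I -> ('I_m -> F) -> F) :
  (forall i, P i -> polyfun D (f i)) ->
  polyfun (count P r * D) (fun x => \prod_(i <- r | P i) f i x).
Proof.
move=> fD; elim: r => [|i r IHr].
  by apply: polyfun_ext (polyfun_cst _ 1) => x; rewrite big_nil.
rewrite /= mulnDl; have [Pi | nPi] := boolP (P i).
  by rewrite mul1n; apply: polyfun_ext (polyfunM (fD i Pi) IHr) => x; rewrite big_cons Pi.
by rewrite mul0n; apply: polyfun_ext IHr => x; rewrite big_cons (negPf nPi).
Qed.

Lemma polyfun_prod_fin (I : finType) (P : pred I) D (f : I -> ('I_m -> F) -> F) :
  (forall i, P i -> polyfun D (f i)) ->
  polyfun (#|P| * D) (fun x => \prod_(i | P i) f i x).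
Proof.
move=> fD; have -> : #|P| = count P (index_enum I).
  by rewrite -sum1_card -sum1_count; apply: eq_bigl.
exact: polyfun_prod.
Qed.

Lemma polyfun_det n D (A : ('I_m -> F) -> 'M[F]_n) :
  (forall i j, polyfun D (fun x => A x i j)) -> polyfun (n * D) (fun x => \det (A x)).
Proof.
move=> AD; apply: polyfun_sum => s _.
apply: (@polyfunM 0 (n * D)); first exact: polyfun_cst.
rewrite -[in X in polyfun X](card_ord n).
by apply: polyfun_prod_fin => i _; apply: AD.
Qed.

Lemma polyfun_adj n D (A : ('I_m -> F) -> 'M[F]_n) i j :
  (forall i j, polyfun D (fun x => A x i j)) -> polyfun (n * D) (fun x => \adj (A x) i j).
Proof.
move=> AD; suff: polyfun (n.-1 * D) (fun x => cofactor (A x) j i).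
  move/(polyfun_le (leq_mul (leq_pred n) (leqnn D))).
  by apply: polyfun_ext => x; rewrite mxE.
apply: (@polyfunM 0); first exact: polyfun_cst.
apply: polyfun_det => i' j'.
by apply: polyfun_ext (AD (lift j i') (lift i j')) => x; rewrite !mxE.
Qed.

Lemma polyfun_mulmx n1 n2 n3 D1 D2 (A : ('I_m -> F) -> 'M[F]_(n1, n2))
    (B : ('I_m -> F) -> 'M[F]_(n2, n3)) i j :
  (forall i j, polyfun D1 (fun x => A x i j)) ->
  (forall i j, polyfun D2 (fun x => B x i j)) ->
  polyfun (D1 + D2) (fun x => (A x *m B x) i j).
Proof.
move=> AD BD; apply: (@polyfun_ext _ (fun x => \sum_k A x i k * B x k j)).
  by move=> x; rewrite mxE.
by apply: polyfun_sum => k _; apply: polyfunM.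
Qed.

(** Merging monomials with equal exponents leaves one coefficient for each of the [D.+1 ^ m]
    exponent functions; this fixed index set bounds the dimension in the count of zero patterns. *)
Lemma polyfun_coef D f : polyfun D f ->
  exists c : {ffun 'I_m -> 'I_D.+1} -> F,
    forall x, f x = \sum_e c e * \prod_l x l ^+ e l.
Proof.
move=> [s [sD fE]].
pose e (t : F * {ffun 'I_m -> nat}) : {ffun 'I_m -> 'I_D.+1} := [ffun l => inord (t.2 l)].
exists (fun e0 => \sum_(t <- s | e t == e0) t.1) => x.
under eq_bigr do rewrite mulr_suml.
rewrite (exchange_big_dep predT) //= fE [LHS]big_seq [RHS]big_seq; apply: eq_bigr => t ts.
rewrite (big_pred1 (e t)); last by move=> e0; rewrite /= eq_sym.
congr (_ * _); apply: eq_bigr => l _; rewrite ffunE inordK //.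
by rewrite ltnS sD.
Qed.

(* Ronyai, Babai and Ganapathy: if Z is the support at x_Z, the product g_Z of
   the f_i over Z vanishes at x_Z' unless Z is contained in Z'; hence the g_Z
   are linearly independent, in a space spanned by few monomials. *)
Lemma zero_patterns (I : finType) D (f : I -> ('I_m -> F) -> F) :
  (forall i, polyfun D (f i)) ->
  exists ZZ : {set {set I}},
    (#|ZZ| <= (#|I| * D).+1 ^ m)%N /\ forall x, [set i | f i x != 0] \in ZZ.
Proof.
move=> fD; pose supp x := [set i | f i x != 0].
pose ZZ := [set Z | `[< exists x, supp x = Z >]]; exists ZZ.
split=> [|x]; last by rewrite inE; apply/asboolP; exists x.
have /choice[pt ptE] (Z : 'I_#|ZZ|) : exists x, supp x = enum_val Z.
  by have := enum_valP Z; rewrite inE => /asboolP.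
pose g (Z : 'I_#|ZZ|) x := \prod_(i in enum_val Z) f i x.
have gD Z : polyfun (#|I| * D) (g Z).
  by apply: polyfun_le (polyfun_prod_fin (fun i _ => fD i)); rewrite leq_mul2r max_card orbT.
have /choice[c cE] Z := polyfun_coef (gD Z).
have gpt Z Z' : (g Z (pt Z') != 0) = (enum_val Z \subset enum_val Z').
  rewrite prodf_seq_neq0 -(ptE Z'); apply/allP/subsetP => gZ i.
    by move=> iZ; rewrite inE; have /implyP := gZ i (mem_index_enum i); apply.
  by move=> _; apply/implyP => /gZ; rewrite inE.
pose E := {ffun 'I_m -> 'I_(#|I| * D).+1}.
pose C : 'M[F]_(#|ZZ|, #|E|) := \matrix_(Z, e) c Z (enum_val e).
suff: row_free C.
  rewrite /row_free => /eqP <-; apply: leq_trans (rank_leq_col _) _.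
  by rewrite card_ffun !card_ord.
rewrite -kermx_eq0; apply/rowV0P => a /sub_kermxP aC0.
have ag0 x : \sum_Z a 0 Z * g Z x = 0.
  under eq_bigr => Z _ do rewrite cE mulr_sumr.
  rewrite exchange_big /= big1 // => e _.
  transitivity ((a *m C) 0 (enum_rank e) * \prod_l x l ^+ e l); last first.
    by rewrite aC0 mxE mul0r.
  by rewrite mxE mulr_suml; apply: eq_bigr => Z _; rewrite !mxE enum_rankK mulrA.
apply/rowP => Z0; rewrite mxE; apply/eqP/negPn/negP => aZ0.
(* [Z] has least size among the patterns with nonzero coefficient. At [pt Z], any other surviving
   term would have its pattern inside [Z], hence equal to [Z]. *)
have [Z aZ Zmin] := @arg_minnP _ Z0 (fun Z => a 0 Z != 0) (fun Z => #|enum_val Z|) aZ0.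
have := ag0 (pt Z); rewrite (bigD1 Z) //= big1 ?addr0 => [|Z' nZ'].
  by move/eqP; rewrite mulf_eq0 (negPf aZ) /=; apply/negP; rewrite gpt.
have [-> | aZ'] := eqVneq (a 0 Z') 0; first by rewrite mul0r.
have [-> | ] := eqVneq (g Z' (pt Z)) 0; first by rewrite mulr0.
rewrite gpt => sZ; case/negP: nZ'; apply/eqP/enum_val_inj/eqP.
by rewrite eqEcard sZ Zmin.
Qed.

End PolynomialFunctions.

(** * Sparse row bases of symmetric matrices *)

Section SparseRowBasis.
Variables (F : fieldType) (n : nat).
Local Open Scope ring_scope.
Implicit Types (S T J : {set 'I_n}) (A M N : 'M[F]_n).

(** The coordinate projection onto [S]: submatrices keep size [n], with the rows or columns outside
    [S] set to zero. *)
Definition dmx S : 'M[F]_n := diag_mx (\row_i (i \in S)%:R).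
Definition supp A : {set 'I_n * 'I_n} := [set e | A e.1 e.2 != 0].

Lemma submx_of_rank A M : (A <= M)%MS -> \rank A = \rank M -> (M <= A)%MS.
Proof.
by move=> AM rAM; have [_] := mxrank_leqif_eq AM; rewrite rAM eqxx => /esym/andP[].
Qed.

Lemma mul_dmxE S A i j : (dmx S *m A) i j = if i \in S then A i j else 0.
Proof. by rewrite mul_diag_mx !mxE; case: (i \in S); rewrite ?mul1r ?mul0r. Qed.

Lemma mul_mx_dmxE S A i j : (A *m dmx S) i j = if j \in S then A i j else 0.
Proof. by rewrite mul_mx_diag !mxE; case: (j \in S); rewrite ?mulr1 ?mulr0. Qed.

Lemma row_mul_dmx S A i : row i (dmx S *m A) = if i \in S then row i A else 0.
Proof. by apply/rowP => j; rewrite mxE mul_dmxE; case: ifP; rewrite mxE. Qed.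

Lemma tr_dmx S : (dmx S)^T = dmx S.
Proof. exact: tr_diag_mx. Qed.

Lemma mul_dmx S T : dmx S *m dmx T = dmx (S :&: T).
Proof.
apply/matrixP => i j; rewrite mul_dmxE !mxE inE.
by case: (i \in S); rewrite ?mul0rn.
Qed.

Lemma dmxC S : dmx S + dmx (~: S) = 1%:M.
Proof.
apply/matrixP => i j; rewrite !mxE inE.
by case: (i \in S); rewrite ?mul0rn ?addr0 ?add0r.
Qed.

Lemma dmx0 : dmx set0 = 0.
Proof. by apply/matrixP => i j; rewrite !mxE inE mul0rn. Qed.

Lemma dmxMS S T N : S \subset T -> (dmx S *m N <= dmx T *m N)%MS.
Proof. by move/setIidPl=> {1}<-; rewrite -mul_dmx -mulmxA submxMl. Qed.

Lemma rank_dmx S : (\rank (dmx S) <= #|S|)%N.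
Proof.
have -> : dmx S = \sum_(i in S) delta_mx i i.
  apply/matrixP => i j; rewrite !mxE summxE.
  have [iS | iNS] := boolP (i \in S); last first.
    rewrite mul0rn big1 // => k kS; rewrite mxE; case: eqP => // ik.
    by rewrite ik kS in iNS.
  rewrite (bigD1 i) //= big1 ?addr0 ?mxE ?eqxx 1?eq_sym // => k /andP[_ /negPf ki].
  by rewrite mxE eq_sym ki.
rewrite -sum1_card; elim/big_ind2: _ => [|A a B b Aa Bb|i _]; first by rewrite mxrank0.
  by apply: leq_trans (mxrank_add _ _) _; apply: leq_add.
by rewrite mxrank_delta.
Qed.

(** Matroid augmentation: for [J'] maximal among the independent row sets between [J] and [T], a row
    of [T] outside its span could still be added. *)
Lemma extend_row_basis N J T : J \subset T -> \rank (dmx J *m N) = #|J| ->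
  exists J', [/\ J \subset J', J' \subset T,
    \rank (dmx J' *m N) = #|J'| & \rank (dmx T *m N) = #|J'|].
Proof.
move=> JT rJ; pose P J' := (J' \subset T) && (\rank (dmx J' *m N) == #|J'|).
have PJ : P J by rewrite /P JT rJ eqxx.
have [J' /maxsetP[/andP[J'T /eqP rJ'] J'max] JJ'] := maxset_exists PJ.
exists J'; split=> //; rewrite -rJ'; apply/eqP; rewrite eqn_leq [X in _ && X]mxrankS ?dmxMS //.
rewrite andbT mxrankS //.
apply/row_subP => i; rewrite row_mul_dmx; case: ifP => [iT | _]; last exact: sub0mx.
apply/negPn/negP => niJ'; pose J'' := i |: J'.
have rowiJ'' : (row i N <= dmx J'' *m N)%MS.
  by have := row_sub i (dmx J'' *m N); rewrite row_mul_dmx setU11.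
have J'J'' : (dmx J' *m N < dmx J'' *m N)%MS.
  rewrite ltmxE dmxMS ?subsetUr //=.
  by apply: contra niJ'; apply: submx_trans.
have iJ' : i \notin J'.
  apply: contra niJ' => iJ'.
  by have := row_sub i (dmx J' *m N); rewrite row_mul_dmx iJ'.
have J''E : J'' = J'.
  apply: J'max; last exact: subsetUr.
  rewrite /P subUset sub1set iT J'T /= eqn_leq.
  rewrite (leq_trans (mxrankM_maxl _ _) (rank_dmx _)) /= cardsU1 iJ' -rJ'.
  exact: rank_ltmx.
by rewrite J''E ltmx_irrefl in J'J''.
Qed.

(* The row basis is chosen greedily by increasing weight: for every [th] it
   contains a basis of the rows of weight at most [th], whose rank is bounded
   below by density; summing over [th] compares the total weights. *)
Lemma light_row_basis N S (w : 'I_n -> nat) (b : nat) :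
    (forall i, (w i <= b)%N) ->
    (forall T, T \subset S ->
       (\rank (dmx S *m N) * #|T| <= \rank (dmx T *m N) * #|S|)%N) ->
  exists J, [/\ J \subset S, \rank (dmx J *m N) = #|J|,
    \rank (dmx S *m N) = #|J| &
    (#|S| * \sum_(i in J) w i <= \rank (dmx S *m N) * \sum_(i in S) w i)%N].
Proof.
move=> wb dens; pose T th := [set i in S | (w i <= th)%N].
have TS th : T th \subset S by apply/subsetP => i; rewrite inE => /andP[].
(* The last conjunct is a layer-cake bound on the weight of [J], written without subtraction: at
   least as many rows of [J] as the rank of [T tau] have weight at most [tau]. *)
have greedy th : exists J, [/\ J \subset T th, \rank (dmx J *m N) = #|J|,
    \rank (dmx (T th) *m N) = #|J| &
    (\sum_(i in J) w i + \sum_(tau < th) \rank (dmx (T tau) *m N) <= th * #|J|)%N].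
  elim: th => [|th [J [JT rJ rT wJ]]].
    have [||J [_ JT rJ rT]] := @extend_row_basis N set0 (T 0%N); first exact: sub0set.
      by rewrite dmx0 mul0mx mxrank0 cards0.
    exists J; split=> //; rewrite big_ord0 addn0 mul0n leqn0 sum_nat_eq0.
    apply/forall_inP => i /(subsetP JT); rewrite inE => /andP[_].
    by rewrite leqn0.
  have [|J' [JJ' J'T rJ' rT']] := @extend_row_basis N J (T th.+1) _ rJ.
    apply: subset_trans JT _; apply/subsetP => i; rewrite !inE => /andP[-> /=].
    exact: leqW.
  exists J'; split=> //; rewrite big_ord_recr /= rT.
  have wJ' : (\sum_(i in J') w i <= \sum_(i in J) w i + th.+1 * (#|J'| - #|J|))%N.
    rewrite (big_setID J) /= (setIidPr JJ') leq_add2l.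
    have -> : (#|J'| - #|J| = #|J' :\: J|)%N by rewrite cardsD (setIidPr JJ').
    rewrite mulnC -sum_nat_const; apply: leq_sum => i; rewrite inE => /andP[_].
    by move/(subsetP J'T); rewrite inE => /andP[].
  have := subnK (subset_leq_card JJ').
  move: wJ wJ'; set a := (#|J'| - #|J|)%N => wJ wJ' <-.
  rewrite mulnDr [(_ * #|J|)%N]mulSn; move: (th.+1 * a)%N (th * #|J|)%N wJ wJ' => c c'.
  by move: (\sum_(i in J') _)%N (\sum_(i in J) _)%N (\sum_(tau < th) _)%N => x y z; lia.
have [J [JT rJ rT wJ]] := greedy b; have TbS : T b = S.
  by apply/setP => i; rewrite inE wb andbT.
rewrite TbS in JT rT; exists J; split=> //.
have count_lt k : (\sum_(tau < b) (tau < k) = minn b k)%N.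
  elim: b {wb greedy J JT rJ rT wJ TbS} => [|b IHb]; first by rewrite big_ord0 min0n.
  by rewrite big_ord_recr /= IHb; lia.
have layers : (\sum_(i in S) w i = \sum_(tau < b) (#|S| - #|T tau|))%N.
  transitivity (\sum_(i in S) \sum_(tau < b) (tau < w i))%N.
    by apply: eq_bigr => i _; rewrite count_lt (minn_idPr (wb i)).
  rewrite exchange_big /=; apply: eq_bigr => tau _.
  rewrite -cardsDS // -sum1_card -big_mkcondr /=; apply: eq_bigl => i.
  by rewrite !inE ltnNge; case: (i \in S); case: (_ <= _)%N.
rewrite layers [leqRHS]big_distrr /=.
(* The scaled greedy bound and the layers of [S] share the total [#|S| * (b * #|J|)]; density
   compares the two sums over [T tau] threshold by threshold, and cancelling leaves the claim. *)
have : (#|S| * \sum_(i in J) w i + \sum_(tau < b) #|S| * \rank (dmx (T tau) *m N)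
        <= #|S| * (b * #|J|))%N by rewrite -big_distrr -mulnDr leq_mul2l wJ orbT.
have : (\sum_(tau < b) \rank (dmx S *m N) * #|T tau| <=
        \sum_(tau < b) #|S| * \rank (dmx (T tau) *m N))%N.
  by apply: leq_sum => tau _; rewrite [leqRHS]mulnC dens.
have : (\sum_(tau < b) \rank (dmx S *m N) * (#|S| - #|T tau|) +
        \sum_(tau < b) \rank (dmx S *m N) * #|T tau| = #|S| * (b * #|J|))%N.
  rewrite -big_split /= rT -rT.
  under eq_bigr => tau _ do rewrite -mulnDr subnK ?subset_leq_card //.
  by rewrite sum_nat_const card_ord rT; lia.
move=> total low up; have := leq_trans (leq_trans (leq_add (leqnn _) low) up) (eq_leq (esym total)).
by rewrite leq_add2r.
Qed.

(* The averaging of Golovnev, Regev and Weinstein: restrict to a principal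
   submatrix minimizing the ratio of rank to size. *)
Lemma sparse_principal_submatrix M : (0 < n)%N -> M^T = M -> (forall i, M i i != 0) ->
  exists S J, let N := dmx S *m M *m dmx S in
  [/\ J \subset S, \rank (dmx J *m N) = #|J|, \rank N = #|J|,
      (0 < #|S| <= #|supp (dmx J *m N)|)%N &
      (n * #|supp (dmx J *m N)| <= \rank M * #|supp N|)%N].
Proof.
move=> n_gt0 Msym Mdiag; pose rk S := \rank (dmx S *m M *m dmx S).
have T0 : [set: 'I_n] != set0 by apply/set0Pn; exists (Ordinal n_gt0); rewrite inE.
pose ratio S : rat := (rk S)%:R / #|S|%:R.
have [S Sn0 Smin] : exists2 S, S != set0 &
    forall T, (rk S * #|T| <= rk T * #|S|)%N.
  have [S Sn0 Smin] := @arg_minP _ rat _ setT (fun S => S != set0) ratio T0.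
  exists S => // T; have [-> | Tn0] := eqVneq T set0; first by rewrite cards0 muln0.
  have := Smin T Tn0; rewrite /ratio ler_pdivrMr ?ltr0n ?card_gt0 //.
  by rewrite mulrAC ler_pdivlMr ?ltr0n ?card_gt0 // -!natrM ler_nat.
pose N := dmx S *m M *m dmx S.
have DSN : dmx S *m N = N by rewrite /N !mulmxA mul_dmx setIid.
pose rsupp A i := [set j | A i j != 0].
have suppE A : #|supp A| = (\sum_i #|rsupp A i|)%N.
  rewrite -sum1_card (eq_bigl (fun e => A e.1 e.2 != 0)); last by move=> e; rewrite inE.
  rewrite -(pair_big_dep predT (fun i j => A i j != 0) (fun _ _ => 1%N)) /=.
  by apply: eq_bigr => i _; rewrite -sum1_card; apply: eq_bigl => j; rewrite inE.
have suppD A T : #|supp (dmx T *m A)| = (\sum_(i in T) #|rsupp A i|)%N.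
  rewrite suppE [RHS]big_mkcond /=; apply: eq_bigr => i _.
  case: ifP => iT; last first.
    by apply/eqP; rewrite cards_eq0; apply/eqP/setP => j; rewrite !inE mul_dmxE iT eqxx.
  by apply: eq_card => j; rewrite !inE mul_dmxE iT.
have [||J [JS rJ rS wJ]] := @light_row_basis N S (fun i => #|rsupp N i|) n.
- by move=> i; rewrite -[leqRHS]card_ord; apply: max_card.
- move=> T TS; rewrite DSN; apply: leq_trans (Smin T) _; rewrite leq_mul2r; apply/orP; right.
  suff -> : rk T = \rank (dmx T *m N *m dmx T) by apply: mxrankM_maxl.
  by rewrite /rk /N -!mulmxA mul_dmx !mulmxA mul_dmx (setIidPl TS) (setIidPr TS).
rewrite DSN in rS wJ.
exists S, J => /=; rewrite -/N; split=> //.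
  rewrite card_gt0 Sn0 /=.
  have [W NE] : exists W, N = W *m (dmx J *m N).
    by apply/submxP/submx_of_rank; rewrite ?rJ ?rS // submxMl.
  (* A column of [S] vanishing in the row basis would vanish in all of [N], against its nonzero
     diagonal entry. *)
  have snd_supp : S \subset [set e.2 | e in supp (dmx J *m N)].
    apply/subsetP => j jS; apply/negPn/negP => jN.
    suff : N j j = 0.
      by move/eqP; rewrite /N mul_mx_dmxE mul_dmxE jS (negPf (Mdiag j)).
    rewrite NE mxE big1 // => i _.
    have [-> | ne0] := eqVneq ((dmx J *m N) i j) 0; first by rewrite mulr0.
    by case/imsetP: jN; exists (i, j); rewrite ?inE.
  by apply: leq_trans (subset_leq_card snd_supp) (leq_imset_card _ _).
have S_gt0 : (0 < #|S|)%N by rewrite card_gt0.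
rewrite -(leq_pmul2l S_gt0) suppD -[N in supp N]DSN suppD.
(* Minimality of the ratio, tested on the full index set. *)
have SMn : (#|J| * n <= \rank M * #|S|)%N.
  have := Smin setT; rewrite cardsT card_ord /rk -/N rS => /leq_trans -> //.
  rewrite leq_mul2r; apply/orP; right.
  by apply: leq_trans (mxrankM_maxl _ _) (mxrankM_maxr _ _).
rewrite rS in wJ.
by nia.
Qed.

(* With [B] invertible extending the block of [N] on [J], symmetry gives
   [N = R^T B^-1 R]. *)
Lemma reconstruct N J : N^T = N -> \rank N = #|J| -> \rank (dmx J *m N) = #|J| ->
  let R := dmx J *m N in let B := R *m dmx J + dmx (~: J) in
  \det B != 0 /\ \det B *: N = R^T *m \adj B *m R.
Proof.
move=> Nsym rN rJ R B.
have DR : dmx J *m R = R by rewrite /R mulmxA mul_dmx setIid.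
have DCR : dmx (~: J) *m R = 0 by rewrite /R mulmxA mul_dmx setIC setICr dmx0 mul0mx.
have RT : R^T = N *m dmx J by rewrite trmx_mul tr_dmx Nsym.
have [Z NE] : exists Z, N = Z *m R.
  by apply/submxP/submx_of_rank; rewrite ?rJ ?rN // submxMl.
have ZR : Z *m dmx J *m R = N by rewrite -mulmxA DR -NE.
have ZB : Z *m dmx J *m B = R^T.
  rewrite /B mulmxDr mulmxA ZR -[in X in _ + X]mulmxA mul_dmx setICr dmx0 mulmx0.
  by rewrite addr0 RT.
(* The rows of [R^T] are supported on [J] and have rank [#|J|], so they generate [dmx J]; [Y] then
   gives the left inverse of [B] in [Bunit]. *)
have [Y YE] : exists Y, dmx J = Y *m R^T.
  apply/submxP/submx_of_rank; first by rewrite RT submxMl.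
  by apply/eqP; rewrite mxrank_tr rJ eqn_leq rank_dmx andbT -{1}rJ mxrankM_maxl.
have DCB : dmx (~: J) *m B = dmx (~: J).
  by rewrite mulmxDr mulmxA DCR mul0mx add0r mul_dmx setIid.
have Bunit : B \in unitmx.
  have /mulmx1_unit[] // : (Y *m (Z *m dmx J) + dmx (~: J)) *m B = 1%:M.
  by rewrite mulmxDl -mulmxA ZB -YE DCB dmxC.
split; first by rewrite -unitfE -unitmxE.
rewrite -ZB -[_ *m B *m _]mulmxA mul_mx_adj mul_mx_scalar -scalemxAl.
by rewrite ZR.
Qed.

End SparseRowBasis.

(** * Counting supports of low rank matrices *)

Section SupportCount.
Variables (F : fieldType) (n : nat).
Local Open Scope ring_scope.
Implicit Types (S T J : {set 'I_n}) (A M N : 'M[F]_n).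

Lemma card_bigcup_le (T U : finType) (f : T -> {set U}) b :
  (forall t, (#|f t| <= b)%N) -> (#|\bigcup_t f t| <= #|T| * b)%N.
Proof.
move=> fb; rewrite -sum_nat_const; elim/big_ind2: _ => [|A a B c Aa Bc|i _] //.
  by rewrite cards0.
by rewrite cardsU (leq_trans (leq_subr _ _)) ?leq_add.
Qed.

(* The enumeration [t] of the support of [R = dmx J *m N] and the entries [x]
   of [R] there determine the support of [N] as a zero pattern. *)
Lemma support_family m : (2 < n)%N ->
  exists ZZ : {set {set 'I_n * 'I_n}}, (#|ZZ| <= n ^ (6 * m))%N /\
    forall N J, N^T = N -> (forall i, i \in J -> N i i != 0) ->
      \rank N = #|J| -> \rank (dmx F J *m N) = #|J| ->
      #|supp (dmx F J *m N)| = m -> supp N \in ZZ.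
Proof.
move=> n_gt2.
pose Rt (t : {ffun 'I_m -> 'I_n * 'I_n}) (x : 'I_m -> F) : 'M[F]_n :=
  \matrix_(i, j) \sum_(l | t l == (i, j)) x l.
(* [J] needs no separate encoding: the diagonal of [N] is nonzero on [J], so [J] is read off the
   diagonal positions listed by [t]. *)
pose Jt (t : {ffun 'I_m -> 'I_n * 'I_n}) := [set i | (i, i) \in codom t].
pose Bt t x := Rt t x *m dmx F (Jt t) + dmx F (~: Jt t).
pose Pt t (e : 'I_n * 'I_n) x := ((Rt t x)^T *m \adj (Bt t x) *m Rt t x) e.1 e.2.
have RtD t i j : polyfun 1 (fun x => Rt t x i j).
  apply: polyfun_ext (_ : polyfun 1 (fun x => \sum_(l | t l == (i, j)) x l)).
    by move=> x; rewrite mxE.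
  by apply: polyfun_sum => l _; apply: polyfun_var.
have BtD t i j : polyfun 1 (fun x => Bt t x i j).
  apply: polyfun_ext (_ : polyfun 1 (fun x =>
     (Rt t x *m dmx F (Jt t)) i j + dmx F (~: Jt t) i j)).
    by move=> x; rewrite [in RHS]mxE.
  apply: polyfunD; last exact: polyfun_cst.
  rewrite -(addn0 1%N); apply: polyfun_mulmx => [|i' j']; first exact: RtD.
  exact: polyfun_cst.
have PtD t e : polyfun n.+2 (Pt t e).
  have -> : n.+2 = (1 + n * 1 + 1)%N by lia.
  apply: polyfun_mulmx => [i j|]; last exact: RtD.
  apply: polyfun_mulmx => i' j'; last by apply: polyfun_adj; apply: BtD.
  by apply: polyfun_ext (RtD t j' i') => x; rewrite [in RHS]mxE.
have /choice[ZZ ZZP] t := zero_patterns (PtD t).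
exists (\bigcup_t ZZ t); split.
  (* There are [n ^ (2 * m)] enumerations [t], each with at most [(n ^ 2 * n.+2).+1 ^ m] patterns,
     and [n ^ 2 * n.+2 + 1 <= n ^ 4] for [n > 2]. *)
  apply: leq_trans (card_bigcup_le (b := (n ^ 4) ^ m) _) _.
    move=> t; apply: leq_trans (proj1 (ZZP t)) _.
    have expW a b : (a <= b -> a ^ m <= b ^ m)%N.
      by move=> ab; case: (m) => // m'; rewrite leq_exp2r.
    by apply: expW; rewrite card_prod card_ord; nia.
  by rewrite card_ffun card_prod !card_ord -expnMn mulnn -expnD expnM.
move=> N J Nsym NJ rN rJ cJ; pose R := dmx F J *m N.
pose cs : #|supp R| = m := cJ.
pose t := [ffun l : 'I_m => enum_val (cast_ord (esym cs) l)].
have tR e : e \in codom t = (e \in supp R).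
  apply/codomP/idP => [[l ->]|eR]; first by rewrite ffunE enum_valP.
  by exists (cast_ord cs (enum_rank_in eR e)); rewrite ffunE cast_ordK enum_rankK_in.
have tinj : injective t.
  by move=> l l'; rewrite !ffunE => /enum_val_inj/cast_ord_inj.
pose x l := R (t l).1 (t l).2.
have RtE : Rt t x = R.
  apply/matrixP => i j; rewrite mxE.
  have [/codomP[l lE]|ij] := boolP ((i, j) \in codom t).
    rewrite (big_pred1 l) => [|l']; first by rewrite /x -lE.
    by rewrite lE /= (inj_eq tinj).
  rewrite big1 => [|l /eqP lE]; last by rewrite -lE codom_f in ij.
  by move: ij; rewrite tR inE negbK => /eqP.
have JtE : Jt t = J.
  apply/setP => i; rewrite inE tR inE /= mul_dmxE.
  by have [/NJ ->|] := boolP (i \in J); rewrite ?eqxx.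
have [] := reconstruct Nsym rN rJ; rewrite -/R => dB NE.
apply/bigcupP; exists t => //.
suff -> : supp N = [set e | Pt t e x != 0] by have [_] := ZZP t; apply.
by apply/setP => e; rewrite !inE /Pt /Bt RtE JtE -NE !mxE mulf_eq0 (negPf dB).
Qed.

(** Adapts the family to the union bound: only positions above the diagonal are potential edges, and
    passing to them costs a factor 4 in the sparsity inequality. *)
Lemma low_rank_supports : (2 < n)%N ->
  exists ZZ : nat -> {set {set 'I_n * 'I_n}},
    (forall m, (#|ZZ m| <= n ^ (6 * m))%N) /\
    forall M k, M^T = M -> (forall i, M i i != 0) -> (\rank M <= k)%N -> (2 * k <= n)%N ->
      exists m Z, [/\ (0 < m <= n ^ 2)%N, Z \in ZZ m, Z \subset supp M &
        (n * m <= 4 * k * #|Z :&: upper n|)%N].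
Proof.
move=> n_gt2; have /choice[ZZ ZZP] m := support_family m n_gt2.
exists ZZ; split=> [m|M k Msym Mdiag Mk kn]; first by have [] := ZZP m.
have [|S [J []]] := sparse_principal_submatrix _ Msym Mdiag; first by lia.
set N := dmx F S *m M *m dmx F S => JS rJ rN.
set m := #|supp _| => /andP[S_gt0 Sm] nm.
have NE i j : N i j = if (i \in S) && (j \in S) then M i j else 0.
  by rewrite /N mul_mx_dmxE mul_dmxE; case: (i \in S); case: (j \in S).
have Nsym : N^T = N by rewrite /N !trmx_mul !tr_dmx Msym mulmxA.
exists m, (supp N); split.
- rewrite (leq_trans S_gt0 Sm) /m (leq_trans (max_card _)) //.
  by rewrite card_prod !card_ord mulnn.
- have [_ ZN] := ZZP m; apply: (ZN N J) => // i /(subsetP JS) iS.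
  by rewrite NE iS Mdiag.
- by apply/subsetP => e; rewrite !inE NE; case: ifP; rewrite ?eqxx.
have half : (#|supp N| <= 2 * #|supp N :&: upper n| + #|S|)%N.
  rewrite -(cardsID (upper n) (supp N)) mul2n -addnn -addnA leq_add2l.
  pose sw (e : 'I_n * 'I_n) := (e.2, e.1).
  pose X := sw @: (supp N :&: upper n); pose Y := (fun i : 'I_n => (i, i)) @: S.
  apply: (@leq_trans #|X :|: Y|); last first.
    by rewrite cardsU (leq_trans (leq_subr _ _)) // leq_add ?leq_imset_card.
  apply/subset_leq_card/subsetP => -[i j].
  rewrite !inE /= -leqNgt => /andP[ji Nij].
  have [ij|nij] := eqVneq i j.
    apply/orP; right; apply/imsetP; exists i; last by rewrite ij.
    by move: Nij; rewrite NE; case: (i \in S); rewrite ?eqxx.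
  apply/orP; left; apply/imsetP; exists (j, i) => //.
  by rewrite !inE /= -Nsym mxE Nij /= ltn_neqAle ji eq_sym nij.
have nm' : (n * m <= k * #|supp N|)%N by apply: leq_trans nm _; rewrite leq_mul2r Mk orbT.
(* The diagonal contributes at most [k * #|S|], which is at most half of [n * m] and is absorbed on
   the left. *)
have kS : (2 * k * #|S| <= n * m)%N by rewrite leq_mul.
nia.
Qed.

End SupportCount.

(** * Binomial random subsets and graphs *)

Section RandomSubset.
Variables (R : realFieldType) (T : finType) (p : R).
Local Open Scope ring_scope.
Implicit Types (U V A B : {set T}) (f g : {set T} -> R).

(** The expectation of [f] at the random subset of [U] keeping each element independently with
    probability [p]; [U] varies so that edges can be revealed in stages. *)
Definition wexp U f : R :=
  \sum_(A : {set T} | A \subset U) p ^+ #|A| * (1 - p) ^+ (#|U| - #|A|) * f A.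

Lemma eq_wexp U f g : {in [pred A : {set T} | A \subset U], f =1 g} -> wexp U f = wexp U g.
Proof. by move=> fg; apply: eq_bigr => A AU; rewrite fg. Qed.

Lemma wexpZ U c f : wexp U (fun A => c * f A) = c * wexp U f.
Proof. by rewrite /wexp mulr_sumr; apply: eq_bigr => A _; rewrite mulrCA. Qed.

Lemma wexp_sum U (I : Type) (r : seq I) (P : pred I) (f : I -> {set T} -> R) :
  wexp U (fun A => \sum_(i <- r | P i) f i A) = \sum_(i <- r | P i) wexp U (f i).
Proof. by rewrite /wexp exchange_big; apply: eq_bigr => A _; rewrite mulr_sumr. Qed.

Lemma wexpB U f g : wexp U (fun A => f A - g A) = wexp U f - wexp U g.
Proof. by rewrite /wexp -sumrB; apply: eq_bigr => A _; rewrite mulrBr. Qed.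

Lemma wexp0 f : wexp set0 f = f set0.
Proof.
rewrite /wexp (big_pred1 set0) => [|A]; last by rewrite subset0.
by rewrite cards0 !expr0 !mul1r.
Qed.

(** Fubini: intersecting with [U] and [V] identifies subsets of the union with pairs, and the
    weights multiply. *)
Lemma wexp_split U V f : [disjoint U & V] ->
  wexp (U :|: V) f = wexp U (fun A => wexp V (fun B => f (A :|: B))).
Proof.
move=> dUV; have UV0 : U :&: V = set0 by apply/eqP; rewrite setI_eq0.
have restr A B : A \subset U -> B \subset V ->
    (A :|: B) :&: U = A /\ (A :|: B) :&: V = B.
  move=> AU BV; rewrite !setIUl (setIidPl AU) (setIidPl BV).
  have -> : B :&: U = set0.
    by apply/eqP; rewrite -subset0 -UV0 setIC setIS.
  have -> : A :&: V = set0 by apply/eqP; rewrite -subset0 -UV0 setSI.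
  by rewrite setU0 set0U.
rewrite /wexp; under [RHS]eq_bigr => A _ do rewrite mulr_sumr.
rewrite pair_big /=.
rewrite (reindex_onto (fun AB => AB.1 :|: AB.2) (fun C => (C :&: U, C :&: V))) /=; last first.
  by move=> C CUV; rewrite -setIUr (setIidPl CUV).
apply: eq_big => [[A B]|[A B] /andP[_]] /=.
  apply/andP/andP => [[_ /eqP[<- <-]]|[AU BV]]; first by rewrite !subsetIr.
  by have [-> ->] := restr A B AU BV; rewrite setUSS.
case/eqP => AE BE.
have AU : A \subset U by rewrite -AE subsetIr.
have BV : B \subset V by rewrite -BE subsetIr.
have cU (X Y X' Y' : {set T}) : X \subset X' -> Y \subset Y' -> X' :&: Y' = set0 ->
    #|X :|: Y| = (#|X| + #|Y|)%N.
  move=> XX YY XY; rewrite cardsU (_ : X :&: Y = set0) ?cards0 ?subn0 //.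
  by apply/eqP; rewrite -subset0 -XY setISS.
rewrite !(cU _ _ U V) //.
have -> : (#|U| + #|V| - (#|A| + #|B|) = (#|U| - #|A|) + (#|V| - #|B|))%N.
  by have := subset_leq_card AU; have := subset_leq_card BV; lia.
by rewrite !exprD [X in X * f _]mulrACA -!mulrA.
Qed.

Lemma wexp_indep U V f g : [disjoint U & V] ->
  wexp (U :|: V) (fun A => f (A :&: U) * g (A :&: V)) = wexp U f * wexp V g.
Proof.
move=> dUV; rewrite wexp_split // mulrC -wexpZ.
apply: eq_wexp => A AU /=; rewrite mulrC -wexpZ; apply: eq_wexp => B BV /=.
rewrite inE in AU; rewrite inE in BV.
rewrite !setIUl (setIidPl AU) (setIidPl BV).
have -> : B :&: U = set0.
  by apply/eqP; rewrite setI_eq0 disjoint_sym; apply: disjointWr BV dUV.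
have -> : A :&: V = set0 by apply/eqP; rewrite setI_eq0; apply: disjointWl AU dUV.
by rewrite setU0 set0U.
Qed.

Lemma wexp1 U : wexp U (fun=> 1) = 1.
Proof.
rewrite -(set_enum U); elim: (enum U) (enum_uniq U) => [|x s IHs] /=.
  by move=> _; rewrite (_ : [set x in [::]] = set0) ?wexp0 //; apply/setP => y; rewrite !inE.
move=> /andP[xs /IHs sE].
have -> : [set y in x :: s] = [set x] :|: [set y in s] by apply/setP => y; rewrite !inE.
rewrite wexp_split ?disjoints1 ?inE // sE /wexp (bigD1 set0) ?sub0set //=.
rewrite (big_pred1 [set x]) => [|A]; last first.
  rewrite subset1; case: (A =P set0) => [->|_]; rewrite ?orbF ?andbT //.
  by rewrite andbF /= eq_sym; apply/esym/negbTE/set0Pn; exists x; rewrite inE.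
by rewrite cards0 cards1 subnn !expr0 !expr1 !mulr1 mul1r subrK.
Qed.

Lemma wexp_set0 U : wexp U (fun A => (A == set0)%:R) = (1 - p) ^+ #|U|.
Proof.
rewrite /wexp (bigD1 set0) ?sub0set //= eqxx big1 ?addr0 => [|A /andP[_ /negPf->]].
  by rewrite cards0 expr0 mul1r mulr1 subn0.
by rewrite mulr0.
Qed.

Lemma wexp_miss U V : V \subset U ->
  wexp U (fun A => (A :&: V == set0)%:R) = (1 - p) ^+ #|V|.
Proof.
move=> VU; rewrite -wexp_set0 -[RHS]mulr1 -(wexp1 (U :\: V)) -wexp_indep; last first.
  by rewrite -setI_eq0 setDE setICA setICr setI0.
have -> : V :|: (U :\: V) = U by rewrite -[X in X :|: _](setIidPr VU) setID.
by apply: eq_wexp => A _; rewrite mulr1.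
Qed.

Lemma wexp_hit_all (I : eqType) (r : seq I) (S : I -> {set T}) : uniq r ->
    (forall a b, a != b -> [disjoint S a & S b]) ->
  wexp (\bigcup_(a <- r) S a) (fun A => \prod_(a <- r) (A :&: S a != set0)%:R) =
  \prod_(a <- r) (1 - (1 - p) ^+ #|S a|).
Proof.
move=> + dS; elim: r => [|a r IHr] /=; first by rewrite !big_nil wexp0 big_nil.
case/andP=> ar /IHr rE; rewrite !big_cons -rE.
have -> : 1 - (1 - p) ^+ #|S a| = wexp (S a) (fun A => (A != set0)%:R).
  rewrite -{1}(wexp1 (S a)) -wexp_set0 -wexpB; apply: eq_wexp => A _.
  by case: (A == set0); rewrite ?subrr ?subr0.
have dar : [disjoint S a & \bigcup_(b <- r) S b].
  rewrite -setI_eq0 big_distrr /= big_seq big1 // => b br.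
  by apply/eqP; rewrite setI_eq0 dS //; apply: contraNneq ar => ->.
rewrite -wexp_indep //; apply: eq_wexp => A _; rewrite big_cons; congr (_ * _).
rewrite big_seq [RHS]big_seq; apply: eq_bigr => b br.
have Sb : S b \subset \bigcup_(a <- r) S a by rewrite (big_rem b) //= subsetUl.
by rewrite -setIA (setIidPr Sb).
Qed.

Hypothesis p01 : 0 <= p <= 1.

Lemma ler_wexp U f g : (forall A, A \subset U -> f A <= g A) -> wexp U f <= wexp U g.
Proof.
move: p01 => /andP[p0 p1] fg; apply: ler_sum => A /fg; apply: ler_wpM2l.
by rewrite mulr_ge0 // exprn_ge0 // subr_ge0.
Qed.

End RandomSubset.

(** * Greedy colouring of the random graph *)

Section GreedyColoring.
Variables (R : realFieldType) (p : R) (n K : nat).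
Local Open Scope ring_scope.
Hypothesis p01 : 0 <= p <= 1.

Definition colorable (A : {set 'I_n * 'I_n}) : bool :=
  [exists col : {ffun 'I_n -> 'I_K}, [forall e in A, col e.1 != col e.2]].

(* Each vertex is added to a properly coloured graph on the previous ones; it
   fails to fit only if it has a neighbour in every colour class. *)
Lemma colorable_prob (delta : R) : (0 < K)%N -> 0 <= delta ->
    (forall s : 'I_K -> nat, (\sum_a s a <= n)%N ->
       \prod_a (1 - (1 - p) ^+ s a) <= delta) ->
  1 - n%:R * delta <= wexp p (upper n) (fun A => (colorable A)%:R).
Proof.
(* [U t] holds the potential edges with larger endpoint below [t]; going to [t.+1] reveals the edges
   [V] from vertex [t] to earlier ones. *)
move=> K_gt0 d0 dP; pose U t := [set e in upper n | (e.2 < t)%N].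
suff Ut t : (t <= n)%N -> 1 - t%:R * delta <= wexp p (U t) (fun A => (colorable A)%:R).
  have -> : upper n = U n by apply/setP => e; rewrite [RHS]inE ltn_ord andbT.
  exact: Ut.
elim: t => [|t IHt] tn.
  have -> : U 0%N = set0 by apply/setP => e; rewrite [LHS]inE ltn0 andbF inE.
  rewrite wexp0 mul0r subr0; suff -> : colorable set0 by [].
  by apply/existsP; exists [ffun=> Ordinal K_gt0]; apply/forall_inP => e; rewrite inE.
pose v := Ordinal tn; pose V := [set e in upper n | e.2 == v].
have -> : U t.+1 = U t :|: V.
  apply/setP => e; rewrite !inE -andb_orr; congr (_ && _).
  by rewrite ltnS leq_eqVlt orbC.
rewrite wexp_split; last first.
  rewrite -setI_eq0; apply/eqP/setP => e; rewrite !inE.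
  by case: (e.2 =P v) => [->|_]; rewrite ?ltnn ?andbF.
have : 1 - t.+1%:R * delta <= wexp p (U t) (fun A => (colorable A)%:R) - delta.
  by rewrite -natr1 mulrDl mul1r opprD addrA lerD2r; apply: IHt (ltnW tn).
move/le_trans; apply.
rewrite -[X in _ - X]mulr1 -[X in _ - _ * X](wexp1 p (U t)) -wexpZ -wexpB.
apply: ler_wexp => // A AU.
have [/existsP[col /forall_inP colP]|_] := boolP (colorable A); last first.
  rewrite mulr1 sub0r; apply: (@le_trans _ _ 0); first by rewrite oppr_le0.
  by move: p01 => /andP[? ?]; apply: sumr_ge0 => B _; rewrite !mulr_ge0 ?exprn_ge0 ?subr_ge0 ?ler0n.
(* The potential edges from [v] to colour class [a]: [v] can take colour [a] as soon as [B] misses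
   [S a]. *)
pose S a := [set e in V | col e.1 == a].
have SV : V = \bigcup_(a <- index_enum 'I_K) S a.
  apply/setP => e; apply/idP/bigcupP => [eV|[a _]]; last by rewrite inE => /andP[].
  by exists (col e.1) => //; rewrite inE eV eqxx.
have Sdisj a b : a != b -> [disjoint S a & S b].
  move=> ab; rewrite -setI_eq0; apply/eqP/setP => e; rewrite !inE.
  by case: (col e.1 =P a) => [->|_]; rewrite ?(negPf ab) ?andbF.
have SP : \prod_a (1 - (1 - p) ^+ #|S a|) <= delta.
  apply: dP; have <- : #|V| = (\sum_a #|S a|)%N.
    rewrite -sum1_card (partition_big (fun e => col e.1) predT) //=.
    by apply: eq_bigr => a _; rewrite -sum1_card; apply: eq_bigl => e; rewrite [RHS]inE.
  rewrite -[leqRHS]card_ord; apply: leq_trans (leq_imset_card (fun i => (i, v)) _).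
  apply/subset_leq_card/subsetP => -[i j]; rewrite inE => /andP[_ /eqP/= ->].
  by apply/imsetP; exists i.
rewrite mulr1; apply: (@le_trans _ _ (wexp p V (fun B => 1 - \prod_a (B :&: S a != set0)%:R))).
  rewrite wexpB wexp1 lerD2l lerN2; apply: le_trans SP.
  by rewrite -(wexp_hit_all p (index_enum_uniq _) Sdisj) -SV.
apply: ler_wexp => // B BV.
have [/forallP Bhit | ] := boolP [forall a, B :&: S a != set0].
  by rewrite big1 ?subrr ?ler0n // => a _; rewrite Bhit.
rewrite negb_forall => /existsP[a]; rewrite negbK => /eqP BSa.
suff -> : colorable (A :|: B) by rewrite lerBlDr lerDl prodr_ge0.
apply/existsP; exists [ffun i => if i == v then a else col i].
apply/forall_inP => e; rewrite inE !ffunE => /orP[eA|eB].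
  have := subsetP AU e eA; rewrite !inE => /andP[e12 e2t].
  by rewrite !ifN ?colP // -val_eqE /= neq_ltn ?e2t // (ltn_trans e12 e2t).
have eV := subsetP BV e eB; have := eV; rewrite !inE => /andP[e12 /eqP e2v].
rewrite e2v eqxx ifN; last by rewrite -val_eqE /= neq_ltn -[t]/(nat_of_ord v) -e2v e12.
apply/negP => cola; have : e \in B :&: S a by rewrite inE eB inE eV cola.
by rewrite BSa inE.
Qed.

End GreedyColoring.

(** * Union bound against low rank representations *)

Section LowRank.
Variables (R : realFieldType) (p : R) (n : nat).
Local Open Scope ring_scope.
Hypothesis p01 : 0 <= p <= 1.

(** A symmetric variant of the condition that the complement graph has minrank at most [k] over
    [R]. *)
Definition low_rank_rep k (A : {set 'I_n * 'I_n}) : Prop :=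
  exists M : 'M[R]_n, [/\ M^T = M, forall i, M i i != 0, (\rank M <= k)%N &
    forall i j, adj A i j -> M i j = 0].

(** A given [Z] in [ZZ m] is missed with probability at most [rho ^+ m], so level [m] costs
    [(n ^ 6 * rho) ^ m], at most its first power; there are [n ^ 2] levels. *)
Lemma low_rank_prob k (rho : R) : (2 < n)%N -> (2 * k <= n)%N ->
    0 <= rho -> n%:R ^+ 6 * rho <= 1 ->
    (forall m a, (n * m <= 4 * k * a)%N -> (1 - p) ^+ a <= rho ^+ m) ->
  wexp p (upper n) (fun A => (`[< low_rank_rep k A >])%:R) <= n%:R ^+ 8 * rho.
Proof.
move=> n_gt2 kn rho0 rho1 rhoP.
have [ZZ [ZZc ZZP]] := low_rank_supports R n_gt2.
pose P m (Z : {set 'I_n * 'I_n}) := (Z \in ZZ m) && (n * m <= 4 * k * #|Z :&: upper n|)%N.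
pose Phi A : R := \sum_(1 <= m < (n ^ 2).+1) \sum_(Z | P m Z) (A :&: (Z :&: upper n) == set0)%:R.
apply: (@le_trans _ _ (wexp p (upper n) Phi)).
  apply: ler_wexp => // A AU; have Phi0 : 0 <= Phi A.
    by apply: sumr_ge0 => m _; apply: sumr_ge0.
  case: asboolP => // -[M [Msym Mdiag Mk MA]].
  have [m [Z [/andP[m1 mn] ZZm ZM nm]]] := ZZP M k Msym Mdiag Mk kn.
  rewrite /Phi (bigD1_seq m) ?iota_uniq ?mem_index_iota ?m1 ?ltnS //=.
  rewrite (bigD1 Z) /P ?ZZm //= (_ : _ == set0); last first.
    apply/eqP/setP => -[i j]; rewrite !inE; apply/negP => /and3P[ijA ijZ _].
    by have := subsetP ZM _ ijZ; rewrite inE /= MA ?eqxx // /adj ijA.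
  rewrite -addrA lerDl addr_ge0 ?sumr_ge0 // => m' _; exact: sumr_ge0.
rewrite wexp_sum; apply: (@le_trans _ _ (\sum_(1 <= m < (n ^ 2).+1) n%:R ^+ 6 * rho)).
  apply: ler_sum_nat => m /andP[m1 _]; rewrite wexp_sum.
  apply: (@le_trans _ _ (\sum_(Z | P m Z) rho ^+ m)).
    by apply: ler_sum => Z /andP[_ /rhoP]; rewrite wexp_miss ?subsetIr.
  rewrite sumr_const -[X in X <= _]mulr_natl.
  apply: (@le_trans _ _ ((n%:R ^+ 6 * rho) ^+ m)).
    rewrite exprMn -exprM ler_wpM2r ?exprn_ge0 // -natrX ler_nat.
    apply: leq_trans (ZZc m); apply/subset_leq_card/subsetP => Z.
    by case/andP.
  rewrite -{2}[_ * rho]expr1; apply: ler_wiXn2l => //.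
  by rewrite mulr_ge0 ?exprn_ge0.
by rewrite sumr_const_nat subSS subn0 -[leLHS]mulr_natr natrX mulrAC -exprD.
Qed.

End LowRank.

(** * Asymptotics of the dimension scale *)

Section Asymptotics.
Local Open Scope R_scope.

Lemma exp_ge_cube x : 0 <= x -> (x / 3) ^ 3 <= exp x.
Proof.
intros x0; replace x with (x / 3 + (x / 3 + x / 3)) at 2 by lra.
rewrite !exp_plus; simpl; rewrite Rmult_1_r.
pose proof (exp_ineq1_le (x / 3)).
apply Rmult_le_compat; try nra; try lra.
Qed.

(** The cubic bound at [x / 200] has denominator [600 ^ 3], so [x >= 2160000] is enough; this is the
    origin of the threshold 3000000. *)
Lemma sqr_le_exp x : 3000000 <= x -> x * x <= 100 * exp (x / 200).
Proof.
intros x0; pose proof (@exp_ge_cube (x / 200)) as ex; specialize (ex ltac:(lra)).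
assert (x * x * 3000000 <= x * x * x) by nra.
assert ((x / 200 / 3) ^ 3 = x * x * x / 216000000) by field.
nra.
Qed.

Lemma exp_le_compat x y : x <= y -> exp x <= exp y.
Proof.
intros [xy|<-]; [left; apply exp_increasing; lra|lra].
Qed.

Lemma ln_le x y : 0 < x -> x <= y -> ln x <= ln y.
Proof.
intros x0 [xy|<-]; [left; apply ln_increasing; lra|lra].
Qed.

Lemma ln_inv_1B_bounds p (N : R) : 0 < N -> 0 < p <= 1 - / N ->
  p <= ln (/ (1 - p)) <= ln N.
Proof.
intros N0 [p0 p1]; pose proof (Rinv_0_lt_compat N N0).
rewrite ln_Rinv; [split|lra].
  assert (ln (1 - p) <= - p); [|lra].
  rewrite -(ln_exp (- p)); apply ln_le; [lra|].
  pose proof (exp_ineq1_le (- p)); lra.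
assert (- ln N <= ln (1 - p)); [|lra].
rewrite -ln_Rinv; [apply ln_le; lra|lra].
Qed.

(** Prepares the choice of constants: [f >= 576] absorbs additive terms and roundings, [f <= N]
    keeps the target rank below [n / 2], and the last bound makes a vertex uncolourable with
    probability at most [N ^ -2]. *)
Lemma dimension_scale_bounds (N p : R) :
    0 < N -> 3000000 <= ln N -> Rpower N (- (99 / 100)) <= p <= 1 - / N ->
  let L := ln (/ (1 - p)) in let f := N * L / ln N in
  0 < p /\ 0 < L /\ 576 <= f <= N /\
  forall K, 200 * f <= K -> 2 * ln N <= K * exp (- (N * L / K)).
Proof.
intros N0 lN pP L f; set (l := ln N) in *.
assert (p0 : 0 < p) by (pose proof (exp_pos (- (99 / 100) * ln N)); unfold Rpower in pP; lra).
destruct (@ln_inv_1B_bounds p N N0) as [L1 L2]; [lra|]; fold L in L1, L2; fold l in L2.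
assert (fl : f * l = N * L) by (unfold f, l; field; fold l; lra).
(* Isolates the factor [N ^ (1/100)] as a square: since [L >= p], the hypothesis on [p] leaves
   [f * l >= exp (l / 200) ^ 2]. *)
assert (NE : N = exp (l / 200) * (exp (l / 200) * exp (99 / 100 * l))).
  rewrite -!exp_plus; replace (l / 200 + _) with l by field.
  unfold l; rewrite exp_ln; lra.
assert (NL : exp (l / 200) * exp (l / 200) <= f * l).
  rewrite fl {1}NE.
  assert (exp (- (99 / 100) * l) <= L) by (unfold Rpower in pP; fold l in pP; lra).
  assert (E1 : exp (99 / 100 * l) * exp (- (99 / 100) * l) = 1).
    rewrite -exp_plus; replace (_ + _) with 0 by field; apply exp_0.
  pose proof (exp_pos (l / 200)); pose proof (exp_pos (99 / 100 * l)).
  assert (1 <= exp (99 / 100 * l) * L) by (rewrite -{1}E1; apply Rmult_le_compat_l; lra).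
  replace (exp (l / 200) * (exp (l / 200) * exp (99 / 100 * l)) * L)
    with (exp (l / 200) * exp (l / 200) * (exp (99 / 100 * l) * L)) by ring.
  assert (0 < exp (l / 200) * exp (l / 200)) by (apply Rmult_lt_0_compat; lra).
  nra.
pose proof (sqr_le_exp lN) as sq.
pose proof (exp_ineq1_le (l / 200)) as e1.
assert (low : l <= 100 * f).
  assert (l * l <= 100 * f * l) by nra.
  nra.
split; [lra|]; split; [lra|]; split.
  split; [lra|]; apply (Rmult_le_reg_r l); [lra|]; rewrite fl.
  apply Rmult_le_compat_l; lra.
intros K Kf.
assert (K0 : 0 < K) by lra.
assert (mu : N * L / K <= l / 200).
  apply (Rmult_le_reg_r K); [lra|]; unfold Rdiv at 1.
  rewrite Rmult_assoc Rinv_l; [rewrite Rmult_1_r -fl; nra|lra].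
assert (ee : exp (- (l / 200)) <= exp (- (N * L / K))).
  apply exp_le_compat; lra.
apply Rle_trans with (K * exp (- (l / 200))); [|apply Rmult_le_compat_l; lra].
rewrite exp_Ropp; pose proof (exp_pos (l / 200)).
apply (Rmult_le_reg_r (exp (l / 200) * l)); [apply Rmult_lt_0_compat; lra|].
replace (K * / exp (l / 200) * (exp (l / 200) * l)) with (K * l) by (field; lra).
(* [sq] trades [l * l] for [100 * exp (l / 200)], after which [NL] applies. *)
apply Rle_trans with (200 * (f * l)); [|nra].
nra.
Qed.

Lemma exp_tangent mu x : exp (- mu) * (1 + mu - x) <= exp (- x).
Proof.
replace (- x) with (- mu + (mu - x)) by lra; rewrite exp_plus.
apply Rmult_le_compat_l; [left; apply exp_pos|].
pose proof (exp_ineq1_le (mu - x)); lra.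
Qed.

(** Sums [K] tangent bounds taken at [N * L / K]; the linear terms leave [(N - S) * L >= 0]. *)
Lemma mean_tangent K N L S : 0 < K -> S <= N -> 0 <= L ->
  K * exp (- (N * L / K)) <= exp (- (N * L / K)) * (K + K * (N * L / K) - S * L).
Proof.
intros K0 SN L0; rewrite Rmult_comm; apply Rmult_le_compat_l; [left; apply exp_pos|].
replace (K * (N * L / K)) with (N * L) by (field; lra).
nra.
Qed.

Lemma pow_exp_ln q m : 0 < q -> pow q m = exp (- (INR m * ln (/ q))).
Proof.
intros q0; rewrite -Rpower_pow; [|lra]; unfold Rpower; rewrite ln_Rinv; [|lra].
f_equal; ring.
Qed.

Lemma ln_inv_ge0 q : 0 < q <= 1 -> 0 <= ln (/ q).
Proof.
intros q01; rewrite ln_Rinv; [|lra].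
assert (ln q <= ln 1) by (apply ln_le; lra).
rewrite ln_1 in H; lra.
Qed.

Lemma nat_ceil (x : R) : 0 <= x -> exists K : nat, x <= INR K <= x + 1.
Proof.
intros x0; destruct (archimed x); exists (Z.to_nat (up x)).
rewrite INR_IZR_INZ Z2Nat.id; [lra|].
apply le_IZR; lra.
Qed.

End Asymptotics.

(** * Touching spheres *)

Section Geometry.
Local Open Scope ring_scope.

Lemma dist2E d (x y : 'I_d -> R) : dist2 x y = Num.sqrt (\sum_k (x k - y k) ^+ 2).
Proof. by rewrite /dist2 RsqrtE. Qed.

Lemma touching_of_colorable n K (A : {set 'I_n * 'I_n}) :
  colorable K A -> touching_spheres K (adj A).
Proof.
move=> /existsP[col /forall_inP colA].
pose s : R := Num.sqrt 2; have s2 : s ^+ 2 = 2 by rewrite sqr_sqrtr ?ler0n.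
exists (fun i a => if a == col i then s else 0), (fun=> 1).
split=> [i|i j Aij]; first exact: Rlt_0_1.
have nij : col i != col j by case/orP: Aij => /colA //; rewrite eq_sym.
have nji := nij; rewrite eq_sym in nji.
rewrite dist2E (bigD1 (col i)) //= (bigD1 (col j)) //= big1 => [|a /andP[ai aj]].
  rewrite !eqxx (negPf nij) (negPf nji) subr0 sub0r sqrrN addr0 s2.
  have -> : 2 + 2 = (1 + 1) ^+ 2 :> R by rewrite expr2 mulrDl mul1r.
  by rewrite sqrtr_sqr ger0_norm ?addr_ge0 ?ler01.
by rewrite (negPf ai) (negPf aj) subrr expr0n.
Qed.

(** With [a i = |u_i|^2 - r_i^2], the entry is [a i + a j - 2 <u_i, u_j> - 2 r_i r_j]: ranks 1, 1,
    [d] and 1. The diagonal is [- (2 r_i)^2]. *)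
Lemma low_rank_of_touching d n (A : {set 'I_n * 'I_n}) :
  touching_spheres d (adj A) -> low_rank_rep R (d + 3) A.
Proof.
move=> [u [r [r_gt0 touch]]].
pose M : 'M[R]_n := \matrix_(i, j) (\sum_k (u i k - u j k) ^+ 2 - (r i + r j) ^+ 2).
exists M; split.
- apply/matrixP => i j; rewrite !mxE [r j + _]addrC; congr (_ - _).
  by apply: eq_bigr => k _; rewrite -sqrrN opprB.
- move=> i; rewrite mxE big1 => [|k _]; last by rewrite subrr expr0n.
  rewrite sub0r oppr_eq0 expf_neq0 // -mulr2n mulrn_eq0 /=.
  by apply/eqP => r0; have := r_gt0 i; rewrite r0 => /Rlt_irrefl.
- pose a i := \sum_k u i k ^+ 2 - r i ^+ 2.
  pose U : 'M[R]_(n, d) := \matrix_(i, k) u i k; pose rc : 'cV[R]_n := \col_i r i.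
  have -> : M = (\col_i a i) *m (const_mx 1 : 'rV_n) + (const_mx 1 : 'cV_n) *m \row_i a i
                + (- 2 *: U) *m U^T + (- 2 *: rc) *m rc^T.
    apply/matrixP => i j.
    have UE : ((- 2 *: U) *m U^T) i j = - ((\sum_k u i k * u j k) *+ 2).
      transitivity (- 2 * \sum_k u i k * u j k); last by rewrite mulNr mulr_natl.
      rewrite mulr_sumr mxE.
      by apply: eq_bigr => k _; rewrite !mxE mulrA.
    rewrite [RHS]mxE [X in X + _]mxE UE !mxE !big_ord1 !mxE mulr1 mul1r /a.
    under eq_bigr => k _ do rewrite sqrrB.
    rewrite big_split sumrB /= sumrMnl sqrrD -mulrA mulNr mulr_natl.
    by rewrite !opprD !addrA [LHS](ACl (1*5*4*8*2*3*6*7)).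
  have rank_add (X Y : 'M[R]_n) b c :
      (\rank X <= b)%N -> (\rank Y <= c)%N -> (\rank (X + Y)%R <= b + c)%N.
    by move=> Xb Yc; rewrite (leq_trans (mxrank_add X Y)) ?leq_add.
  have -> : (d + 3 = 1 + 1 + d + 1)%N by lia.
  apply: (rank_add _ _ _ _ _ (mulmx_max_rank _ _)).
  apply: (rank_add _ _ _ _ _ (mulmx_max_rank _ _)).
  exact: (rank_add _ _ _ _ (mulmx_max_rank _ _) (mulmx_max_rank _ _)).
move=> i j /touch; rewrite dist2E RplusE mxE => <-.
by rewrite sqr_sqrtr ?subrr // sumr_ge0 // => k _; apply: sqr_ge0.
Qed.

End Geometry.

(** * Probability estimates for [prob_Gnp] and for one greedy step *)

Section Probability.
Local Open Scope ring_scope.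

Lemma prob_GnpE n p (E : {set 'I_n * 'I_n} -> Prop) :
  prob_Gnp p E = wexp p (upper n) (fun A => (`[< E A >])%:R).
Proof.
rewrite /prob_Gnp /wexp; apply: eq_bigr => A _; rewrite !RpowE.
by case: excluded_middle_informative => EA; case: asboolP.
Qed.

Lemma prob_Gnp_le1 n p (E : {set 'I_n * 'I_n} -> Prop) : 0 <= p <= 1 -> prob_Gnp p E <= 1.
Proof.
move=> p01; rewrite prob_GnpE -(wexp1 p (upper n)); apply: ler_wexp => // A _.
by case: asboolP; rewrite ?wexp1.
Qed.

Lemma prob_Gnp_ge n p (E : {set 'I_n * 'I_n} -> Prop) K k : 0 <= p <= 1 ->
    (forall A, colorable K A -> ~ low_rank_rep R k A -> E A) ->
  wexp p (upper n) (fun A => (colorable K A)%:R) -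
  wexp p (upper n) (fun A => (`[< low_rank_rep R k A >])%:R) <= prob_Gnp p E.
Proof.
move=> p01 EP; rewrite prob_GnpE -wexpB; apply: ler_wexp => // A _.
have [cA|_] := boolP (colorable K A); last first.
  by rewrite sub0r; apply: (@le_trans _ _ 0); rewrite ?oppr_le0 ler0n.
case: asboolP => [_|nlow]; first by rewrite subrr ler0n.
by rewrite subr0; case: asboolP => // nE; case: nE; apply: EP.
Qed.

Lemma exp_sum (I : Type) (r : seq I) (x : I -> R) :
  \prod_(i <- r) exp (x i) = exp (\sum_(i <- r) x i).
Proof. by rewrite (big_morph exp exp_plus exp_0). Qed.

(* Tangent line of the exponential: the sum of the [q ^+ s a] is at least its
   value when all the [s a] are equal. *)
Lemma prod_1B_pow_le q n K (s : 'I_K -> nat) : 0 < q <= 1 -> (0 < K)%N ->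
    (\sum_a s a <= n)%N ->
  \prod_a (1 - q ^+ s a) <= exp (- (INR K * exp (- (INR n * ln (/ q) / INR K)))).
Proof.
move=> /andP[q0 q1] K0 sn; pose L := ln (/ q).
have /RltP KR : Rlt 0 (INR K) by apply/lt_0_INR/ssrnat.ltP.
have L0 : Rle 0 L by apply: ln_inv_ge0; split; [apply/RltP|apply/RleP].
apply: (@le_trans _ _ (\prod_a exp (- q ^+ s a))).
  apply: ler_prod => a _; rewrite subr_ge0 exprn_ile1 ?(ltW q0) //=.
  by apply/RleP; apply: exp_ineq1_le.
rewrite exp_sum; apply/RleP/exp_le_compat/RleP.
rewrite sumrN lerN2; pose mu : R := INR n * L / INR K.
apply: (@le_trans _ _ (\sum_a exp (- mu) * (1 + mu - INR (s a) * L))); last first.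
  apply: ler_sum => a _; rewrite -RpowE pow_exp_ln; last exact/RltP.
  exact/RleP/exp_tangent.
rewrite -mulr_sumr sumrB sumr_const card_ord -mulr_suml -[_ *+ K]mulr_natl -INRE.
have sumE : \sum_a INR (s a) = INR (\sum_a s a).
  by rewrite INRE natr_sum; apply: eq_bigr => a _; rewrite INRE.
rewrite sumE [_ * (1 + mu)]mulrDr mulr1; apply/RleP/mean_tangent => //; first exact/RltP.
exact/le_INR/ssrnat.leP.
Qed.

End Probability.

(** * Choice of constants and the limit *)

Section Main.
Local Open Scope R_scope.

Lemma prob_dimension_bounds n p : (2 < n)%N -> 3000000 <= ln (INR n) ->
    Rpower (INR n) (- (99 / 100)) <= p <= 1 - / INR n ->
  let f := INR n * ln (/ (1 - p)) / ln (INR n) in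
  1 - 2 / INR n <=
    prob_Gnp p (fun A : {set 'I_n * 'I_n} =>
                  min_touch_dim_between (adj A) (/ 144 * f) (201 * f)) <= 1.
Proof.
move=> n_gt2 ln_n pP f; set N := INR n in pP f ln_n *.
have N3 : 3 <= N.
  have -> : 3 = INR 3 by rewrite /=; lra.
  by apply/le_INR/ssrnat.leP.
have N0 : 0 < N by lra.
have [p0 [L0 [[f1 f2] fK]]] := dimension_scale_bounds N0 ln_n pP.
have p1 := proj2 pP; have iN : 0 < / N by apply: Rinv_0_lt_compat; lra.
rewrite -/f in f1 f2 fK; set L := ln _ in L0 f f1 f2 fK *.
set l := ln N in ln_n f f1 f2 fK *.
have fl : f * l = N * L by rewrite /f; field; lra.
have [K [K1 K2]] : exists K : nat, 200 * f <= INR K <= 200 * f + 1 by apply: nat_ceil; lra.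
have [k [k1 k2]] : exists k : nat, f / 144 + 3 <= INR k <= f / 144 + 3 + 1.
  by apply: nat_ceil; lra.
have p01 : (0 <= p <= 1)%O.
  by apply/andP; split; apply/RleP; [change (0 <= p)|change (p <= 1)]; lra.
split; last exact/RleP/prob_Gnp_le1.
have powN m : (/ N) ^ m = exp (- (INR m * l)) by rewrite pow_exp_ln // Rinv_inv.
have NN : N * / N = 1 by apply: Rinv_r; lra.
have powq m : (1 - p) ^ m = exp (- (INR m * L)) by apply: pow_exp_ln; lra.
have col : 1 - N * (/ N) ^ 2 <=
    wexp p (upper n) (fun A => GRing.natmul (GRing.one R) (colorable K A)).
  have K0 : (0 < K)%N by apply/ssrnat.ltP/INR_lt; rewrite /=; lra.
  rewrite [X in 1 - X * _]INRE; apply/RleP/colorable_prob => //.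
    by apply/RleP; change (0 <= (/ N) ^ 2); apply: pow_le; lra.
  move=> s sn; apply: le_trans (prod_1B_pow_le _ K0 sn) _.
    by apply/andP; split; [apply/RltP|apply/RleP]; [change (0 < 1 - p)|change (1 - p <= 1)]; lra.
  apply/RleP; rewrite powN; apply: exp_le_compat; apply: Ropp_le_contravar.
  exact: fK.
(* Here [rho = N ^ -9], so low rank has probability at most [/ N], as does failure of the
   colouring. *)
have low : wexp p (upper n) (fun A => GRing.natmul (GRing.one R) `[< low_rank_rep R k A >])
    <= N ^ 8 * (/ N) ^ 9.
  rewrite [X in X ^ 8]INRE RpowE; apply/RleP/low_rank_prob => //.
  - apply/ssrnat.leP/INR_le; rewrite -multE mult_INR -/N /=; lra.
  - by apply/RleP; change (0 <= (/ N) ^ 9); apply: pow_le; lra.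
  - rewrite -RpowE -INRE -/N; apply/RleP; change (N ^ 6 * (/ N) ^ 9 <= 1).
    replace (N ^ 6 * (/ N) ^ 9) with ((N * / N) ^ 6 * (/ N) ^ 3) by ring.
    rewrite NN pow1 Rmult_1_l; rewrite -(pow1 3); apply: pow_incr; split; first lra.
    by rewrite -Rinv_1; apply: Rinv_le_contravar; lra.
  (* The goal amounts to [9 * m * l <= a * L]; from [N * m <= 4 * k * a <= f * a / 18] and
     [f * l = N * L] one even gets [18 * m * l <= a * L]. *)
  move=> m a /ssrnat.leP/le_INR; rewrite -!multE !mult_INR -/N => nma.
  rewrite -!RpowE; apply/RleP; rewrite -pow_mult powq powN.
  apply: exp_le_compat; apply: Ropp_le_contravar; rewrite mult_INR.
  have a0 := pos_INR a; have m0 := pos_INR m.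
  have E4 : INR 4 = 4 by rewrite /=; lra.
  have E9 : INR 9 = 9 by rewrite /=; lra.
  rewrite E9; rewrite E4 in nma.
  have kf : INR k * INR a <= f / 72 * INR a by apply: Rmult_le_compat_r; lra.
  have Nm : N * INR m * l <= f / 18 * INR a * l by apply: Rmult_le_compat_r; lra.
  apply: (Rmult_le_reg_r N); first lra.
  replace (INR a * L * N) with (INR a * (f * l)) by (rewrite fl; ring).
  have : 0 <= f * l * INR a by rewrite fl; apply: Rmult_le_pos; [nra|].
  nra.
apply: Rle_trans (_ : 1 - N * (/ N) ^ 2 - N ^ 8 * (/ N) ^ 9 <= _).
  replace (N ^ 8 * (/ N) ^ 9) with ((N * / N) ^ 8 * / N) by ring.
  replace (N * (/ N) ^ 2) with (N * / N * / N) by ring.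
  by rewrite NN pow1 /Rdiv; lra.
apply: Rle_trans (_ : _ <= wexp p (upper n) (fun A => GRing.natmul (GRing.one R) (colorable K A))
  - wexp p (upper n) (fun A => GRing.natmul (GRing.one R) `[< low_rank_rep R k A >])) _.
  by lra.
apply/RleP/prob_Gnp_ge => // A colA nlow; split.
  by exists K; split; [exact: touching_of_colorable|lra].
move=> d /low_rank_of_touching [M [Msym Mdiag Md MA]]; apply: Rnot_lt_le => df.
apply: nlow; exists M; split=> //; apply: leq_trans Md _.
apply/ssrnat.leP/INR_le; rewrite -plusE plus_INR.
have -> : INR 3 = 3 by rewrite /=; lra.
lra.
Qed.

End Main.

Theorem theorem4p3 :
  exists c C : R, Rlt R0 c /\ Rlt c C /\
    forall p : nat -> R,
      (exists N : nat, forall n : nat, is_true (leq N n) ->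
         Rle (Rpower (INR n) (Ropp (Rdiv (INR 99) (INR 100)))) (p n) /\
         Rle (p n) (Rminus R1 (Rinv (INR n)))) ->
      Un_cv (fun n : nat =>
               @prob_Gnp n (p n) (fun A =>
                 let f := Rdiv (Rmult (INR n) (ln (Rinv (Rminus R1 (p n))))) (ln (INR n)) in
                 min_touch_dim_between (adj A) (Rmult c f) (Rmult C f)))
            R1.
Proof.
exists (Rinv (IZR 144)), (IZR 201); split; first by apply: Rinv_0_lt_compat; lra.
split; first lra.
move=> p [N NP] eps eps0.
(* [N1] makes [ln n] exceed the threshold; [N2] makes the failure bound [2 / n] smaller than [eps],
   strictly because [n >= N2.+1]. *)
have [N1 [N1P _]] := nat_ceil (Rlt_le _ _ (exp_pos (IZR 3000000))).
have [N2 [N2P _]] : exists K : nat,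
    Rle (Rdiv (IZR 2) eps) (INR K) /\ Rle (INR K) (Rplus (Rdiv (IZR 2) eps) (IZR 1)).
  by apply: nat_ceil; apply: Rlt_le; apply: Rdiv_lt_0_compat; lra.
exists (N + N1 + N2 + 3) => n /ssrnat.leP n_large.
have le_n m : m <= n -> Rle (INR m) (INR n) by move=> mn; apply/le_INR/ssrnat.leP.
have n0 : Rlt R0 (INR n) by apply/lt_0_INR/ssrnat.ltP; lia.
have N2n : Rle (INR N2.+1) (INR n) by apply: le_n; lia.
rewrite S_INR in N2n.
have pP : Rle (Rpower (INR n) (Ropp (Rdiv (IZR 99) (IZR 100)))) (p n) /\
          Rle (p n) (Rminus R1 (Rinv (INR n))).
  have [|p0 p1] := NP n; first by lia.
  by split=> //; move: p0; rewrite !INR_IZR_INZ.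
have ln_n : Rle (IZR 3000000) (ln (INR n)).
  rewrite -(ln_exp (IZR 3000000)); apply: ln_le; first exact: exp_pos.
  by apply: Rle_trans N1P (le_n _ _); lia.
have [|lo hi] := prob_dimension_bounds _ ln_n pP; first by lia.
have small : Rlt (Rdiv (IZR 2) (INR n)) eps.
  apply: (Rmult_lt_reg_r (INR n)) => //.
  have -> : Rmult (Rdiv (IZR 2) (INR n)) (INR n) = Rmult (Rdiv (IZR 2) eps) eps.
    by field; split; lra.
  rewrite [Rmult eps _]Rmult_comm; apply: Rmult_lt_compat_r => //.
  by apply: Rle_lt_trans N2P _; lra.
set P := prob_Gnp _ _; rewrite /Rdist.
have {}lo : Rle (Rminus (IZR 1) (Rdiv (IZR 2) (INR n))) P := lo.
have {}hi : Rle P (IZR 1) := hi.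
by apply: Rabs_def1; lra.
Qed.
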